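(* Let $\gamma>0$ and let $F=(F_1,\dots,F_n):[B(\mathcal H)^n]_\gamma\to[B(\mathcal H)^n]_\gamma$ be a free holomorphic function such that $F(0)=0$ and $F'(0)=I_n$. Then $F(X_1,\dots,X_n)=(X_1,\dots,X_n)$ for all $(X_1,\dots,X_n)\in[B(\mathcal H)^n]_\gamma$. *)

(* Defs.v *)
(* Complex scalars are R[i] (real-closed's
   complex numbers over a realType R). *)
From mathcomp Require Import all_boot all_order all_algebra.
From mathcomp Require Export complex.
From mathcomp Require Export all_classical all_reals all_analysis.
Set Implicit Arguments. Unset Strict Implicit. Unset Printing Implicit Defensive.
Import Order.TTheory GRing.Theory Num.Theory.
Local Open Scope ring_scope.
Local Open Scope classical_set_scope.
Import numFieldNormedType.Exports.

(* Complex Hilbert spaces                                                    *)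

(* norm induced by an inner product ip (linear in the first variable) *)
Definition hnorm (R : realType) (H : lmodType R[i]) (ip : H -> H -> R[i])
  (x : H) : R := Num.sqrt (complex.Re (ip x x)).

(* (H, ip) is a complex Hilbert space: ip is an inner product and H is
   complete for the induced norm. *)
Record is_hilbert (R : realType) (H : lmodType R[i]) (ip : H -> H -> R[i])
  : Prop := IsHilbert {
  ip_linear : forall (a : R[i]) (x y z : H), ip (a *: x + y) z = a * ip x z + ip y z;
  ip_hermitian : forall x y : H, ip y x = (ip x y)^*;
  ip_pos : forall x : H, 0 <= ip x x;
  ip_definite : forall x : H, ip x x = 0 -> x = 0;
  ip_complete : forall u : nat -> H,
    (forall e : R, 0 < e -> exists N : nat, forall m k : nat,
        (N <= m)%N -> (N <= k)%N -> hnorm ip (u m - u k) < e) ->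
    exists l : H, forall e : R, 0 < e -> exists N : nat, forall m : nat,
        (N <= m)%N -> hnorm ip (u m - l) < e
}.

(* Bounded operators B(H)                                                    *)

(* T : H -> H is a bounded linear operator, i.e. T \in B(H) *)
Definition bounded_op (R : realType) (H : lmodType R[i]) (ip : H -> H -> R[i])
  (T : H -> H) : Prop :=
  (forall (a : R[i]) (x y : H), T (a *: x + y) = a *: T x + T y) /\
  exists M : R, forall x : H, hnorm ip (T x) <= M * hnorm ip x.

(* operator norm ||T|| = sup { ||T x|| : ||x|| <= 1 } *)
Definition opnorm (R : realType) (H : lmodType R[i]) (ip : H -> H -> R[i])
  (T : H -> H) : R :=
  sup [set r : R | exists x : H, hnorm ip x <= 1 /\ r = hnorm ip (T x)].

(* S is the adjoint T^* of T *)
Definition is_adjoint (R : realType) (H : lmodType R[i]) (ip : H -> H -> R[i])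
  (T S : H -> H) : Prop :=
  forall x y : H, ip (T x) y = ip x (S y).

(* The noncommutative ball
   [B(H)^n]_gamma = { (X_1,...,X_n) in B(H)^n : ||X_1 X_1^* + ... + X_n X_n^*||^(1/2) < gamma } *)
Definition nc_ball (R : realType) (H : lmodType R[i]) (ip : H -> H -> R[i])
  (n : nat) (gamma : R) (X : 'I_n -> H -> H) : Prop :=
  (forall i, bounded_op ip (X i)) /\
  exists Xs : 'I_n -> H -> H, (forall i, is_adjoint ip (X i) (Xs i)) /\
    Num.sqrt (opnorm ip (fun h => \sum_(i < n) X i (Xs i h))) < gamma.

(* Free holomorphic functions                                                *)

(* X_alpha = X_{i_1} X_{i_2} ... X_{i_k} for the word alpha = i_1 i_2 ... i_k;
   X_{empty word} = identity. *)
Definition Xword (R : realType) (H : lmodType R[i]) (n : nat)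
  (X : 'I_n -> H -> H) (alpha : seq 'I_n) : H -> H :=
  foldr (fun i f => X i \o f) id alpha.

(* partial sums  sum_{k < N} sum_{|alpha| = k} a_alpha X_alpha  of the free series *)
Definition psum (R : realType) (H : lmodType R[i]) (n : nat)
  (a : seq 'I_n -> R[i]) (X : 'I_n -> H -> H) (N : nat) : H -> H :=
  fun h => \sum_(k < N) \sum_(alpha : k.-tuple 'I_n)
             a (tval alpha) *: Xword X (tval alpha) h.

(* The free series  f = sum_alpha a_alpha Z_alpha  evaluated at X converges
   in the operator norm of B(H) to G, i.e. f(X) = G. *)
Definition nc_value (R : realType) (H : lmodType R[i]) (ip : H -> H -> R[i])
  (n : nat) (a : seq 'I_n -> R[i]) (X : 'I_n -> H -> H) (G : H -> H) : Prop :=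
  bounded_op ip G /\
  (fun N : nat => opnorm ip (fun h => psum a X N h - G h)) @ \oo --> (0 : R).

(* sum_{|alpha| = k} |a_alpha|^2 *)
Definition coef_norm2 (R : realType) (n : nat) (a : seq 'I_n -> R[i]) (k : nat)
  : R := \sum_(alpha : k.-tuple 'I_n) complex.Re (a (tval alpha) * (a (tval alpha))^*).

(* The free series has radius of convergence >= gamma:
   limsup_k (sum_{|alpha|=k} |a_alpha|^2)^{1/(2k)} <= 1/gamma.
   Such a series defines a free holomorphic function on [B(H)^n]_gamma. *)
Definition free_holo_on (R : realType) (n : nat) (gamma : R)
  (a : seq 'I_n -> R[i]) : Prop :=
  (limn_esup (fun k : nat => ((coef_norm2 a k) `^ ((2 * k%:R)^-1))%:E)
     <= (gamma^-1)%:E)%E.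

(* F'(0) = [ (d F_i / d Z_j)(0) ]_{i,j}: the free partial derivative of
   F_i = sum_alpha a^{(i)}_alpha Z_alpha with respect to Z_j at 0 is the
   coefficient a^{(i)}_{g_j} of the word of length one. *)
Definition free_deriv0 (R : realType) (n : nat) (a : 'I_n -> seq 'I_n -> R[i])
  : 'M[R[i]]_n := \matrix_(i < n, j < n) a i [:: j].

(* Main.v *)
(* Call a row [V] coisometric when [sum V_i V_i^* = gamma^2], and let [F_k] be the
   degree [k] part of the series.  For [r < 1], [|z| = 1] and every row of vectors
   [u], the point [r z V] lies in the ball, hence so does [F (r z V)] and
   [2 Re <F (r z V) u, h> <= gamma^2 |h|^2 + |u|^2].  Taking
   [u = z^-1 V^* h + s z^-k y] with [k <> 1] and averaging over [z] isolates
   [F_1 (V) V^* h = gamma^2 h] and [F_k (V) y]; letting [r -> 1] and then [s -> 0]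
   gives [F_k (V) y = 0].  So [F_k] vanishes on coisometric rows.

   Coisometric rows are preserved by right multiplication by the unitaries
   [1 + c v v^*], and [F_k] is a polynomial in [c] along this curve, so its
   derivative at [V] in the direction [V v v^*] vanishes; by polarization the same
   holds in all finite-rank directions.  Iterating, all derivatives at [V] vanish,
   so [F_k] vanishes at all finite-rank perturbations of [V], and therefore
   everywhere. *)
Require Import Defs.
From mathcomp Require Import all_boot all_order all_algebra.
From mathcomp Require Import complex.
From mathcomp Require Import all_classical all_reals all_analysis.
From mathcomp Require Import ring lra.
Import Order.TTheory GRing.Theory Num.Theory.
From mathcomp Require cyclic separable cyclotomic.
Local Open Scope ring_scope.

(** * Linear maps on a module *)

Section LinearMaps.
Context (K : pzRingType) (E : lmodType K) (T : E -> E) (lT : linear T).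

Lemma linD x y : T (x + y) = T x + T y.
Proof. by have := lT 1 x y; rewrite !scale1r. Qed.

Lemma lin0 : T 0 = 0.
Proof. by apply: (addrI (T 0)); rewrite -linD !addr0. Qed.

Lemma linZ c x : T (c *: x) = c *: T x.
Proof. by have := lT c x 0; rewrite lin0 !addr0. Qed.

Lemma lin_sum I (r : seq I) (P : pred I) (F : I -> E) :
  T (\sum_(i <- r | P i) F i) = \sum_(i <- r | P i) T (F i).
Proof. exact: (big_morph T linD lin0). Qed.

End LinearMaps.

(** * Algebra of the inner product *)

Section InnerProduct.
Context {R : realType} {H : lmodType R[i]} {ip : H -> H -> R[i]}
  (hH : is_hilbert ip).
Implicit Types (x y z h : H).

Lemma ipDl x y z : ip (x + y) z = ip x z + ip y z.
Proof. by have := ip_linear hH 1 x y z; rewrite scale1r mul1r. Qed.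

Lemma ip0l z : ip 0 z = 0.
Proof. by apply: (addrI (ip 0 z)); rewrite -ipDl !addr0. Qed.

Lemma ipZl c x z : ip (c *: x) z = c * ip x z.
Proof. by have := ip_linear hH c x 0 z; rewrite ip0l !addr0. Qed.

Lemma ip_suml I (r : seq I) (P : pred I) (F : I -> H) z :
  ip (\sum_(i <- r | P i) F i) z = \sum_(i <- r | P i) ip (F i) z.
Proof. exact: (big_morph (ip^~ z) (fun x y => ipDl x y z) (ip0l z)). Qed.

Lemma ipDr x y z : ip z (x + y) = ip z x + ip z y.
Proof. by rewrite (ip_hermitian hH) ipDl rmorphD /= -!(ip_hermitian hH). Qed.

Lemma ip0r z : ip z 0 = 0.
Proof. by rewrite (ip_hermitian hH) ip0l rmorph0. Qed.

Lemma ipZr c x z : ip z (c *: x) = c^* * ip z x.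
Proof. by rewrite (ip_hermitian hH) ipZl rmorphM /= -(ip_hermitian hH). Qed.

Lemma ip_sumr I (r : seq I) (P : pred I) (F : I -> H) z :
  ip z (\sum_(i <- r | P i) F i) = \sum_(i <- r | P i) ip z (F i).
Proof. exact: (big_morph (ip z) (fun x y => ipDr x y z) (ip0r z)). Qed.

(** Pairing with [q j] gives a scalar polynomial with more roots than its degree allows; its
    vanishing [j]-th coefficient is [<q j, q j>]. *)
Lemma vector_poly_eq0 (N : nat) (q : nat -> H) (c : nat -> R[i]) :
  injective c -> (forall s, \sum_(j < N) c s ^+ j *: q j = 0) ->
  forall j, (j < N)%N -> q j = 0.
Proof.
move=> c_inj q0 j jN; apply: (ip_definite hH).
set p := \poly_(k < N) ip (q k) (q j).
suff p0 : p = 0 by have := coef_poly N (fun k => ip (q k) (q j)) j;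
  rewrite -/p p0 coef0 jN => <-.
apply: contraTeq isT => p_neq0.
have := @max_poly_roots _ p (map c (iota 0 N)) p_neq0.
rewrite map_inj_uniq // iota_uniq size_map size_iota ltnNge size_poly /= => -> //.
apply/allP => _ /mapP[s _ ->]; apply/rootP; rewrite horner_poly.
transitivity (ip (\sum_(k < N) c s ^+ k *: q k) (q j)); last by rewrite q0 ip0l.
by rewrite ip_suml; apply: eq_bigr => k _; rewrite ipZl mulrC.
Qed.

(* To extend [Q] to a new vector [v], add [h |-> <(1 - Q) h, d> d / <d, d>] with
   [d = v - Q v]; this vanishes on [L] without any orthogonality. *)
Lemma finite_rank_identity_on (L : seq H) :
  exists (r : seq (H * H)), forall h, h \in L ->
    \sum_(p <- r) ip h p.1 *: p.2 = h.
Proof.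
elim: L => [|v L [r Hr]]; first by exists [::].
pose Q h := \sum_(p <- r) ip h p.1 *: p.2.
pose d := v - Q v.
have [d0|d_neq0] := eqVneq d 0.
  exists r => h; rewrite in_cons => /predU1P[->|/Hr//].
  by apply/eqP; rewrite eq_sym -subr_eq0; apply/eqP.
(* [w] is [(1 - Q)^* d / <d, d>], written out through the adjoint of the finite-rank [Q]. *)
pose w := (ip d d)^-1 *: (d - \sum_(p <- r) (ip p.2 d)^* *: p.1).
have dd_neq0 : ip d d != 0.
  by apply: contra_neq d_neq0 => /(ip_definite hH).
have Hw h : ip h w = (ip d d)^-1 * ip (h - Q h) d.
  rewrite ipZr fmorphV /= -(ip_hermitian hH); congr (_ * _).
  rewrite ipDr ipDl -(scaleN1r (Q h)) -(scaleN1r (\sum_(_ <- _) _)) ipZr ipZl.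
  rewrite rmorphN1 ip_sumr ip_suml; congr (_ + _ * _).
  by apply: eq_bigr => p _; rewrite ipZr ipZl conjCK mulrC.
exists ((w, d) :: r) => h; rewrite in_cons big_cons /= Hw.
case/predU1P=> [->|hL].
  by rewrite mulVf // scale1r subrK.
by rewrite /Q Hr // subrr ip0l mulr0 scale0r add0r.
Qed.

End InnerProduct.

(** * Taylor coefficients of noncommutative monomials *)

Section Rows.
Context {R : realType} {H : lmodType R[i]} {n : nat}.
Implicit Types (X Y Z : 'I_n -> H -> H) (h : H).

(* The coefficient of [s^j t^k] in [Xword (X + s Z + t Y) alpha h]. *)
Fixpoint word_coef X Z Y h (j k : nat) (alpha : seq 'I_n) : H :=
  if alpha is i :: beta then
    X i (word_coef X Z Y h j k beta)
    + (if j is j'.+1 then Z i (word_coef X Z Y h j' k beta) else 0)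
    + (if k is k'.+1 then Y i (word_coef X Z Y h j k' beta) else 0)
  else if (j == 0)%N && (k == 0)%N then h else 0.

Lemma word_coef00 X Z Y h alpha :
  word_coef X Z Y h 0 0 alpha = Xword X alpha h.
Proof. by elim: alpha => //= i alpha ->; rewrite !addr0. Qed.

(** Moving the base point from [X] to [X + c Z] makes each coefficient in [t] a polynomial in [c],
    so derivatives in [c] can be read off algebraically. *)
Lemma word_coef_poly X Z Z' Y h k alpha (N : nat) c :
  (forall i, linear (X i)) -> (forall i, linear (Z i)) ->
  (forall i, linear (Y i)) -> (size alpha <= N)%N ->
  word_coef (fun i x => X i x + c *: Z i x) Z' Y h 0 k alpha =
  \sum_(j < N.+1) c ^+ j *: word_coef X Z Y h j k alpha.
Proof.
move=> lX lZ lY; elim: alpha k N => [|i alpha IH] k N /=.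
  rewrite big_ord_recl big1 ?addr0 ?expr0 ?scale1r // => j _.
  by rewrite /= scaler0.
case: N => // N aN.
under [RHS]eq_bigr => j _ do rewrite !scalerDr.
rewrite !big_split addr0 /=; congr (_ + _ + _).
- rewrite (IH _ N.+1) ?(ltnW aN) // (lin_sum _ _ _ (lX i)).
  by apply: eq_bigr => j _; rewrite (linZ _ _ _ (lX i)).
- rewrite big_ord_recl /= scaler0 add0r (IH _ N) // (lin_sum _ _ _ (lZ i)).
  rewrite scaler_sumr; apply: eq_bigr => j _.
  by rewrite (linZ _ _ _ (lZ i)) scalerA exprS.
- case: k => [|k]; first by rewrite big1 // => j _; rewrite scaler0.
  rewrite (IH _ N.+1) ?(ltnW aN) // (lin_sum _ _ _ (lY i)).
  by apply: eq_bigr => j _; rewrite (linZ _ _ _ (lY i)).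
Qed.

Lemma Xword_add X Z Y h alpha (N : nat) :
  (forall i, linear (X i)) -> (forall i, linear (Y i)) ->
  (size alpha <= N)%N ->
  Xword (fun i x => X i x + Y i x) alpha h =
  \sum_(k < N.+1) word_coef X Z Y h 0 k alpha.
Proof.
move=> lX lY; elim: alpha N => [|i alpha IH] N /=.
  by rewrite big_ord_recl big1 ?addr0.
case: N => // N aN.
rewrite !big_split /= [X in _ = _ + X + _]big1 // addr0; congr (_ + _).
  by rewrite (IH N.+1) ?(ltnW aN) // (lin_sum _ _ _ (lX i)).
by rewrite big_ord_recl /= add0r (IH N) // (lin_sum _ _ _ (lY i)).
Qed.

Lemma word_coef0 X Z Z' Y h k alpha :
  word_coef X Z Y h 0 k alpha = word_coef X Z' Y h 0 k alpha.
Proof.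
elim: alpha k => //= i alpha IH k; rewrite (IH k); congr (_ + _ + _).
by case: k => // k; rewrite IH.
Qed.

(** The coefficient of [s] is a directional derivative, hence linear in the direction [Z]. *)
Lemma word_coef1_sum X Y h k alpha I (r : seq I) (c : I -> R[i])
    (Z : I -> 'I_n -> H -> H) :
  (forall i, linear (X i)) -> (forall i, linear (Y i)) ->
  word_coef X (fun i x => \sum_(s <- r) c s *: Z s i x) Y h 1 k alpha =
  \sum_(s <- r) c s *: word_coef X (Z s) Y h 1 k alpha.
Proof.
move=> lX lY; elim: alpha k => [|i alpha IH] k /=.
  by rewrite big1 // => s _; rewrite scaler0.
under [RHS]eq_bigr => s _ do rewrite !scalerDr.
rewrite !big_split /=; congr (_ + _ + _).
- rewrite IH (lin_sum _ _ _ (lX i)).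
  by apply: eq_bigr => s _; rewrite (linZ _ _ _ (lX i)).
- by apply: eq_bigr => s _; rewrite (word_coef0 _ (Z s) (fun i x => \sum_(s <- r) c s *: Z s i x)).
- case: k => [|k]; first by rewrite big1 // => s _; rewrite scaler0.
  rewrite IH (lin_sum _ _ _ (lY i)).
  by apply: eq_bigr => s _; rewrite (linZ _ _ _ (lY i)).
Qed.

(** With both directions equal to [Y] the word depends on [s + t] only, and [s t^k] occurs in
    [(s + t)^(k+1)] with factor [k + 1]. *)
Lemma word_coef1_diag X Y h k alpha :
  (forall i, linear (X i)) -> (forall i, linear (Y i)) ->
  word_coef X Y Y h 1 k alpha =
  k.+1%:R *: word_coef X Y Y h 0 k.+1 alpha.
Proof.
move=> lX lY; elim: alpha k => [|i alpha IH] k /=; first by rewrite scaler0.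
rewrite addr0 scalerDr IH (linZ _ _ _ (lX i)) -addrA; congr (_ + _).
case: k => [|k]; first by rewrite addr0 scale1r.
by rewrite IH (linZ _ _ _ (lY i)) -[X in X + _]scale1r -scalerDl nat1r.
Qed.

Lemma eq_Xword X X' h (L : seq H) alpha :
  (forall i x, x \in L -> X' i x = X i x) ->
  (forall s, Xword X (drop s alpha) h \in L) ->
  Xword X' alpha h = Xword X alpha h.
Proof.
move=> eqX; elim: alpha => //= i alpha IH inL.
have eqa : Xword X' alpha h = Xword X alpha h.
  by apply: IH => s; apply: (inL s.+1).
rewrite eqa eqX //; have := inL 1%N; by rewrite drop1.
Qed.

Lemma Xword_scale (z : R[i]) X alpha h : (forall i, linear (X i)) ->
  Xword (fun i x => z *: X i x) alpha h = z ^+ size alpha *: Xword X alpha h.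
Proof.
move=> lX; elim: alpha => [|i alpha IH] /=; first by rewrite expr0 scale1r.
by rewrite IH (linZ _ _ _ (lX i)) scalerA -exprS.
Qed.

Lemma Xword_linear X alpha : (forall i, linear (X i)) -> linear (Xword X alpha).
Proof.
by move=> lX; elim: alpha => //= i alpha IH c x y /=; rewrite IH lX.
Qed.

End Rows.

(** * Coisometric rows as a uniqueness set for polynomials *)

Section Coisometries.
Context {R : realType} {H : lmodType R[i]} {ip : H -> H -> R[i]}
  (hH : is_hilbert ip) {n : nat} (gamma : R).

(** Boundedness is derived in [coisometric_bounded], which keeps rank-one updates purely
    algebraic. *)
Definition coisometric (V : 'I_n -> H -> H) : Prop :=
  (forall i, linear (V i)) /\
  exists Vs : 'I_n -> H -> H, (forall i, is_adjoint ip (V i) (Vs i)) /\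
    forall h, \sum_i V i (Vs i h) = (gamma ^+ 2)%:C%C *: h.

(** The row [x w^*], with [w] seen as a vector of [H^n]. *)
Definition rank1 (x : H) (w : 'I_n -> H) : 'I_n -> H -> H :=
  fun i h => ip h (w i) *: x.

Lemma rank1_linear x w i : linear (rank1 x w i).
Proof.
by move=> c y z; rewrite /rank1 (ipDl hH) (ipZl hH) scalerDl scalerA.
Qed.

Lemma finite_rank_linear (r : seq (H * ('I_n -> H))) i :
  linear (fun x => \sum_(p <- r) rank1 p.1 p.2 i x).
Proof.
move=> c y z; rewrite scaler_sumr -big_split /=.
by apply: eq_bigr => p _; rewrite rank1_linear.
Qed.

(** The new row is [V U] with [U = 1 + c v v^*]; the equation on [c] says exactly that
    [U U^* = 1]. *)
Lemma coisometric_update V v c : coisometric V ->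
  c + c^* + c * c^* * (\sum_i ip (v i) (v i)) = 0 ->
  coisometric (fun i x => V i x + c *: rank1 (\sum_j V j (v j)) v i x).
Proof.
set b := \sum_j V j (v j); move=> [lV [Vs [adjV VVs]]] cc.
split=> [i d x y|].
  by rewrite lV rank1_linear !scalerDr addrACA !scalerA (mulrC c).
exists (fun i y => Vs i y + (c^* * ip y b) *: v i); split=> [i x y|y].
  rewrite /rank1 (ipDl hH) !(ipZl hH) (ipDr hH) (ipZr hH) -adjV.
  by rewrite rmorphM /= conjCK -(ip_hermitian hH); ring.
have Vsv : \sum_i ip (Vs i y) (v i) = ip y b.
  rewrite /b (ip_sumr hH); apply: eq_bigr => i _.
  by rewrite (ip_hermitian hH) -adjV -(ip_hermitian hH).
under eq_bigr => i _ do
  rewrite (linD _ _ _ (lV i)) (linZ _ _ _ (lV i)) /rank1 (ipDl hH) (ipZl hH) scalerA.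
rewrite !big_split /= VVs -scaler_sumr -/b -scaler_suml -mulr_sumr big_split /=.
rewrite Vsv -mulr_sumr -[RHS]addr0 -addrA -scalerDl; congr (_ + _).
suff -> : c^* * ip y b + c * (ip y b + c^* * ip y b * \sum_i ip (v i) (v i)) = 0.
  by rewrite scale0r.
by rewrite -[RHS](mulr0 (ip y b)) -[in RHS]cc; ring.
Qed.

(* Cayley parametrisation: [1 + S * c s] runs through the unit circle. *)
Lemma unitary_parameters (S : R[i]) : 0 <= S ->
  exists c : nat -> R[i], injective c /\
    forall s, c s + (c s)^* + c s * (c s)^* * S = 0.
Proof.
move=> S_ge0; pose D (s : nat) : R[i] := 1 - 'i * s.+1%:R * S.
have Sreal : S^* = S by apply/conj_Creal/ger0_real.
have DJ s : (D s)^* = 1 + 'i * s.+1%:R * S.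
  by rewrite /D rmorphB !rmorphM rmorph1 /= conjCi rmorph_nat Sreal !mulNr opprK.
have D_neq0 s : D s != 0.
  apply/eqP => /(congr1 (fun z => z * z^*)); rewrite mul0r DJ => D0.
  have : 1 + (s.+1%:R * S) ^+ 2 = 0.
    rewrite -[RHS]D0 /D; have := sqrCi R[i]; set j := 'i => j2.
    transitivity (1 - j ^+ 2 * (s.+1%:R * S) ^+ 2); last by ring.
    by rewrite j2; ring.
  by apply/eqP; rewrite gt_eqF // ltr_wpDr ?ltr01 // exprn_ge0 // mulr_ge0.
have i_neq0 : 'i != 0 :> R[i] by exact: neq0Ci.
(* With [t = s + 1] this gives [1 + S c = (1 + i t S) / (1 - i t S)]; the formula also covers
   [S = 0], where [c = 2 i t]. *)
exists (fun s => 2 * 'i * s.+1%:R / D s); split=> [s t|s].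
  move/(congr1 (fun z => z * (D s * D t) / (2 * 'i))).
  have -> : 2 * 'i * s.+1%:R / D s * (D s * D t) / (2 * 'i) = s.+1%:R * D t.
    by field; rewrite i_neq0 D_neq0.
  have -> : 2 * 'i * t.+1%:R / D t * (D s * D t) / (2 * 'i) = t.+1%:R * D s.
    by field; rewrite i_neq0 D_neq0.
  move=> st; have : (s.+1%:R : R[i]) = t.+1%:R.
    transitivity (s.+1%:R * D t + 'i * s.+1%:R * t.+1%:R * S).
      by rewrite /D; ring.
    by rewrite st /D; ring.
  by move/eqP; rewrite eqr_nat => /eqP[].
have DJ_neq0 : 1 + 'i * s.+1%:R * S != 0 by rewrite -DJ conjC_eq0.
rewrite !rmorphM /= fmorphV /= DJ conjCi !rmorph_nat.
have := D_neq0 s; rewrite /D; move: DJ_neq0.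
move: (s.+1%:R) => t; move: 'i => j h1 h2.
by field; rewrite h1 h2.
Qed.

(** Induction on [k] for all coisometric [V] at once: the degree [k] coefficient in the fixed
    direction [Y] vanishes along every curve of coisometric rows, so its derivative at [V] does
    too. *)
Lemma word_coef_coisometric_eq0 (m : nat) (a : seq 'I_n -> R[i]) (h : H) :
  gamma != 0 ->
  (forall V, coisometric V ->
     \sum_(alpha : m.-tuple 'I_n) a alpha *: Xword V alpha h = 0) ->
  forall k V (r : seq (H * ('I_n -> H))), coisometric V ->
  let Y := fun i x => \sum_(p <- r) rank1 p.1 p.2 i x in
  \sum_(alpha : m.-tuple 'I_n) a alpha *: word_coef V Y Y h 0 k alpha = 0.
Proof.
move=> gamma_neq0 a0 k V r; elim: k V => [|k IH] V coV Y.
  by under eq_bigr => alpha _ do rewrite word_coef00; exact: a0.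
have lY i : linear (Y i) by exact: finite_rank_linear.
have [lV [Vs [adjV VVs]]] := coV.
(* [L Z] is the derivative at [V], in the direction [Z], of the degree [k] coefficient. *)
pose L Z := \sum_(alpha : m.-tuple 'I_n) a alpha *: word_coef V Z Y h 1 k alpha.
have Lsum I (s : seq I) (c : I -> R[i]) (Z : I -> 'I_n -> H -> H) :
    L (fun i x => \sum_(t <- s) c t *: Z t i x) = \sum_(t <- s) c t *: L (Z t).
  rewrite /L; under [RHS]eq_bigr => t _ do rewrite scaler_sumr.
  rewrite exchange_big /=; apply: eq_bigr => alpha _.
  rewrite word_coef1_sum // scaler_sumr.
  by apply: eq_bigr => t _; rewrite !scalerA mulrC.
pose B (u w : 'I_n -> H) := rank1 (\sum_j V j (u j)) w.
have Ldiag v : L (B v v) = 0.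
  have [|c [c_inj cc]] := unitary_parameters (\sum_i ip (v i) (v i)).
    by apply: sumr_ge0 => i _; exact: (ip_pos hH).
  pose q j := \sum_(alpha : m.-tuple 'I_n) a alpha *: word_coef V (B v v) Y h j k alpha.
  (* The degree in [c] is at most [m]; the bound [m.+2] keeps the index 1 in range when [m = 0]. *)
  apply: (@vector_poly_eq0 _ _ _ hH m.+2 q c c_inj _ 1%N) => // s.
  rewrite -[RHS](IH _ (coisometric_update _ _ _ coV (cc s))) /q.
  under eq_bigr => j _ do rewrite scaler_sumr.
  rewrite exchange_big /=; apply: eq_bigr => alpha _.
  rewrite (@word_coef_poly _ _ _ V (B v v) _ _ _ _ _ m.+1) ?size_tuple //.
    rewrite scaler_sumr; apply: eq_bigr => j _.
    by rewrite !scalerA mulrC.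
  by move=> i; exact: rank1_linear.
have Lpolar u w (e : R[i]) : e^* *: L (B u w) + e *: L (B w u) = 0.
  rewrite -[RHS](Ldiag (fun i => u i + e *: w i)).
  pose s := [:: (1, (u, u)); (e^*, (u, w)); (e, (w, u)); (e * e^*, (w, w))].
  transitivity (L (fun i x => \sum_(t <- s) t.1 *: B t.2.1 t.2.2 i x)).
    rewrite Lsum !big_cons big_nil /= !Ldiag !scaler0 !addr0 add0r //.
  congr L; apply/funext => i; apply/funext => x.
  rewrite !big_cons big_nil /= addr0 scale1r /B /rank1.
  have -> : \sum_j V j (u j + e *: w j) = \sum_j V j (u j) + e *: \sum_j V j (w j).
    rewrite scaler_sumr -big_split; apply: eq_bigr => j _ /=.
    by rewrite (linD _ _ _ (lV j)) (linZ _ _ _ (lV j)).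
  rewrite (ipDr hH) (ipZr hH) !(scalerDl, scalerDr, scalerA).
  by rewrite [RHS]addrACA -!addrA; do 3![congr (_ + _)]; congr (_ *: _); ring.
(* [e = 1] gives [L (B w u) = - L (B u w)]; [e = 'i] then leaves a nonzero multiple of
   [L (B u w)]. *)
have Loff u w : L (B u w) = 0.
  have := Lpolar u w 1; rewrite conjC1 !scale1r => /eqP.
  rewrite addrC addr_eq0 => /eqP wu.
  have := Lpolar u w 'i; rewrite wu conjCi scalerN scaleNr -opprD => /eqP.
  rewrite oppr_eq0 -scalerDl scaler_eq0 -mulr2n mulrn_eq0 /=.
  by rewrite (negPf (neq0Ci _)) => /eqP.
(* [V] is onto: [x = V u] for [u = gamma^-2 V^* x]. *)
have Lrank1 x w : L (rank1 x w) = 0.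
  rewrite -(Loff (fun i => (gamma ^+ 2)^-1%:C%C *: Vs i x) w) /B.
  congr (L (rank1 _ w)).
  under eq_bigr => j _ do rewrite (linZ _ _ _ (lV j)).
  rewrite -scaler_sumr VVs scalerA -rmorphM /= mulVf ?scale1r //.
  by rewrite expf_neq0.
have LY : L Y = 0.
  transitivity (L (fun i x => \sum_(p <- r) 1 *: rank1 p.1 p.2 i x)).
    congr L; apply/funext => i; apply/funext => x.
    by apply: eq_bigr => p _; rewrite scale1r.
  by rewrite Lsum big1 // => p _; rewrite Lrank1 scaler0.
move: LY; rewrite /L.
under eq_bigr => alpha _ do rewrite word_coef1_diag // scalerA mulrC -scalerA.
by rewrite -scaler_sumr => /eqP; rewrite scaler_eq0 pnatr_eq0 /= => /eqP.
Qed.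

(* A polynomial only sees [X] on the finitely many vectors [Xword X beta h], so
   [X] may be replaced by a finite-rank perturbation of a coisometric row. *)
Lemma coisometric_vanishing (i0 : 'I_n) (m : nat) (a : seq 'I_n -> R[i]) (h : H) :
  gamma != 0 ->
  (forall V, coisometric V ->
     \sum_(alpha : m.-tuple 'I_n) a alpha *: Xword V alpha h = 0) ->
  forall X : 'I_n -> H -> H, (forall i, linear (X i)) ->
  \sum_(alpha : m.-tuple 'I_n) a alpha *: Xword X alpha h = 0.
Proof.
move=> gamma_neq0 a0 X lX.
(* The simplest coisometric row: [gamma] times the identity in slot [i0], zero elsewhere. *)
pose V (i : 'I_n) (x : H) : H := if i == i0 then gamma%:C%C *: x else 0.
have lV i : linear (V i).
  move=> c x y; rewrite /V; case: eqP => _; last by rewrite scaler0 addr0.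
  by rewrite scalerDr !scalerA mulrC.
have coV : coisometric V.
  split=> //; exists V; split=> [i x y|x].
    rewrite /V; case: eqP => _; last by rewrite (ip0l hH) (ip0r hH).
    by rewrite (ipZl hH) (ipZr hH) conj_Creal // complex_real eqxx.
  rewrite (bigD1 i0) //= big1 => [|i /negPf ne]; last by rewrite /V ne.
  by rewrite /V eqxx addr0 scalerA -rmorphM.
pose L := [seq Xword X (drop s (tval alpha)) h
          | alpha <- enum {: m.-tuple 'I_n}, s <- iota 0 m.+1].
have inL (alpha : m.-tuple 'I_n) s : Xword X (drop s alpha) h \in L.
  have -> : drop s alpha = drop (minn s m) alpha.
    rewrite /minn; case: ltnP => // ms.
    by rewrite !drop_oversize ?size_tuple.
  apply: (allpairs_f (fun (al : m.-tuple 'I_n) s => Xword X (drop s al) h)).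
    by rewrite mem_enum.
  by rewrite mem_iota add0n ltnS geq_minr.
have [r Hr] := finite_rank_identity_on hH L.
(* If [sum p.2 p.1^*] is the identity on [L], composing it with [X i - V i] in each slot [i] gives a
   finite-rank row equal to [X - V] on [L]. *)
pose rY := [seq (X i p.2 - V i p.2, fun j => if j == i then p.1 else 0)
           | i <- enum 'I_n, p <- r].
pose Y i x := \sum_(p <- rY) rank1 p.1 p.2 i x.
have YE i x : x \in L -> V i x + Y i x = X i x.
  move=> xL; rewrite /Y /rY big_allpairs_dep big_enum /= (bigD1 i) //=.
  rewrite [X in _ + (_ + X)]big1 => [|j ji]; last first.
    rewrite big1 // => p _.
    by rewrite /rank1 /= eq_sym (negPf ji) (ip0r hH) scale0r.
  rewrite addr0 -{1 3}(Hr x xL) !(lin_sum _ _ _ (lX i)) (lin_sum _ _ _ (lV i)).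
  rewrite -big_split /=; apply: eq_bigr => p _; rewrite /rank1 /= eqxx.
  by rewrite (linZ _ _ _ (lX i)) (linZ _ _ _ (lV i)) scalerBr addrC subrK.
transitivity (\sum_(alpha : m.-tuple 'I_n)
    a alpha *: Xword (fun i x => V i x + Y i x) alpha h).
  apply: eq_bigr => alpha _; congr (_ *: _).
  by rewrite (@eq_Xword _ _ _ X _ h L).
under eq_bigr => alpha _.
  rewrite (@Xword_add _ _ _ _ Y _ _ _ m) ?size_tuple //; last first.
    by move=> i; exact: finite_rank_linear.
  rewrite scaler_sumr; over.
rewrite exchange_big big1 // => k _.
exact: (word_coef_coisometric_eq0 _ _ _ gamma_neq0 a0).
Qed.

End Coisometries.

(** * Complex scalars and averages over roots of unity *)

Section ComplexScalars.
Context {R : realType}.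
Implicit Types (z w : R[i]) (t : R).

Lemma ReD z w : complex.Re (z + w) = complex.Re z + complex.Re w.
Proof. by case: z; case: w. Qed.

Lemma ReN z : complex.Re (- z) = - complex.Re z.
Proof. by case: z. Qed.

Lemma Re_sum I (r : seq I) (P : pred I) (F : I -> R[i]) :
  complex.Re (\sum_(i <- r | P i) F i) = \sum_(i <- r | P i) complex.Re (F i).
Proof. exact: (big_morph _ ReD). Qed.

Lemma ReZ t z : complex.Re (t%:C%C * z) = t * complex.Re z.
Proof. by case: z => x y /=; rewrite mul0r subr0. Qed.

Lemma ReJ z : complex.Re z^* = complex.Re z.
Proof. by case: z. Qed.

Lemma conj_realC t : (t%:C%C : R[i])^* = t%:C%C.
Proof. by apply/conj_Creal; rewrite complex_real. Qed.

Lemma ge0_realC z : 0 <= z -> z = (complex.Re z)%:C%C.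
Proof. by move=> z_ge0; rewrite RRe_real // ger0_real. Qed.

Lemma primitive_root_exists (N : nat) : (0 < N)%N ->
  exists z : R[i], N.-primitive_root z.
Proof.
move=> N_gt0; have [r Dr] := closed_field_poly_normal ('X^N - 1 : {poly R[i]}).
rewrite (monicP (monicXnsubC 1 N_gt0)) scale1r in Dr.
have Nr : size r = N.
  by apply: succn_inj; rewrite -(size_prod_XsubC r id) -Dr size_XnsubC.
have /hasP[z _ pz] : has N.-primitive_root r; last by exists z.
apply: cyclic.has_prim_root; rewrite ?Nr //.
  by apply/allP => z; rewrite -root_prod_XsubC -Dr.
rewrite -separable.separable_prod_XsubC -Dr cyclotomic.separable_Xn_sub_1 //.
by rewrite pnatr_eq0 -lt0n.
Qed.

(** A geometric sum whose ratio [w^(k-j)] is an [N]-th root of unity, equal to 1 only for [j = k]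
    since both exponents are below [N]. *)
Lemma root_of_unity_orthogonality (N : nat) (w : R[i]) (j k : nat) :
  N.-primitive_root w -> (j < N)%N -> (k < N)%N ->
  \sum_(l < N) (w ^+ l)^* ^+ j * (w ^+ l) ^+ k = if j == k then N%:R else 0.
Proof.
move=> pw jN kN.
have ww : w * w^* = 1.
  rewrite -normCK; apply/eqP; rewrite sqrp_eq1 //.
  have : `|w| ^+ N = 1 by rewrite -normrX (prim_expr_order pw) normr1.
  by move/eqP; rewrite pexprn_eq1 // => /orP[/eqP N0|//]; rewrite N0 in jN.
have wx l : (w ^+ l)^* ^+ j * (w ^+ l) ^+ k = (w^* ^+ j * w ^+ k) ^+ l.
  by rewrite rmorphXn /= exprMn -!exprM mulnC (mulnC l k).
under eq_bigr => l _ do rewrite wx.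
set x := w^* ^+ j * w ^+ k.
have xN : x ^+ N = 1.
  rewrite exprMn -!exprM mulnC (mulnC k) !exprM -rmorphXn /=.
  by rewrite (prim_expr_order pw) rmorph1 !expr1n mulr1.
have wkx : w ^+ k = w ^+ j * x by rewrite /x mulrA -exprMn ww expr1n mul1r.
case: eqP => [jk|/eqP jk].
  have -> : x = 1 by rewrite /x jk -exprMn mulrC ww expr1n.
  by under eq_bigr => l _ do rewrite expr1n; rewrite sumr_const card_ord.
have x_neq1 : x - 1 != 0.
  apply: contra_neq jk => /eqP; rewrite subr_eq0 => /eqP x1.
  move: wkx; rewrite x1 mulr1 => /esym/eqP.
  by rewrite (eq_prim_root_expr pw) !modn_small // => /eqP.
by apply: (mulfI x_neq1); rewrite -subrX1 xN subrr mulr0.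
Qed.

(* Integrating a trigonometric polynomial over the circle, with the integral
   replaced by an average over roots of unity. *)
Lemma circle_average_bound (K k0 : nat) (b d : nat -> R[i]) (C : R[i]) (E : R) :
  (1 < K)%N -> (k0 < K)%N -> k0 != 1%N ->
  (forall z : R[i], z * z^* = 1 ->
     complex.Re (z^* * \sum_(k < K) z ^+ k * b k
                 + z^* ^+ k0 * \sum_(k < K) z ^+ k * d k)
     <= E + complex.Re (z^* * z ^+ k0 * C)) ->
  complex.Re (b 1%N + d k0) <= E.
Proof.
move=> K1 k0K k01 bound.
have K_gt0 : (0 < K)%N by exact: ltn_trans K1.
have [w pw] := primitive_root_exists _ K_gt0.
have ww l : w ^+ l * (w ^+ l)^* = 1.
  rewrite -normCK normrX; have : `|w| ^+ K = 1.
    by rewrite -normrX (prim_expr_order pw) normr1.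
  by move/eqP; rewrite pexprn_eq1 // -[_ == _ :> nat]negbK -lt0n K_gt0 => /eqP ->;
    rewrite !expr1n.
have moment (j : nat) (f : nat -> R[i]) : (j < K)%N ->
    \sum_(l < K) (w ^+ l)^* ^+ j * \sum_(k < K) (w ^+ l) ^+ k * f k = K%:R * f j.
  move=> jK; under eq_bigr => l _ do rewrite mulr_sumr.
  rewrite exchange_big /= (bigD1 (Ordinal jK)) //= [X in _ + X]big1 => [|k kj].
    rewrite addr0; under eq_bigr => l _ do rewrite mulrA.
    by rewrite -mulr_suml root_of_unity_orthogonality // eqxx.
  under eq_bigr => l _ do rewrite mulrA.
  rewrite -mulr_suml root_of_unity_orthogonality //.
  by rewrite eq_sym -(inj_eq val_inj) in kj; rewrite (negPf kj) mul0r.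
have m1 : \sum_(l < K) (w ^+ l)^* * \sum_(k < K) (w ^+ l) ^+ k * b k = K%:R * b 1%N.
  exact: (moment 1%N b K1).
(* The cross term with [C] averages out because [k0] differs from 1. *)
have m0 : \sum_(l < K) (w ^+ l)^* * (w ^+ l) ^+ k0 = 0.
  have := root_of_unity_orthogonality K w 1 k0 pw K1 k0K.
  by rewrite eq_sym (negPf k01).
have : \sum_(l < K) complex.Re ((w ^+ l)^* * \sum_(k < K) (w ^+ l) ^+ k * b k
         + (w ^+ l)^* ^+ k0 * \sum_(k < K) (w ^+ l) ^+ k * d k)
    <= \sum_(l < K) (E + complex.Re ((w ^+ l)^* * (w ^+ l) ^+ k0 * C)).
  by apply: ler_sum => l _; apply: bound.
rewrite -Re_sum !big_split /= m1 (moment k0 d k0K) -Re_sum -mulr_suml m0.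
rewrite mul0r addr0 sumr_const card_ord -mulrDr.
have -> : (K%:R : R[i]) = K%:R%:C%C by rewrite rmorph_nat.
by rewrite ReZ -[E *+ K]mulr_natl ler_pM2l // ltr0n.
Qed.

End ComplexScalars.

(** * The Hilbert norm and the Cauchy-Schwarz inequality *)

Section HilbertNorm.
Context {R : realType} {H : lmodType R[i]} {ip : H -> H -> R[i]}
  (hH : is_hilbert ip).
Implicit Types (x y : H).
Local Notation hn := (hnorm ip).

Definition hnorm2 x : R := complex.Re (ip x x).

Lemma ip_hnorm2 x : ip x x = (hnorm2 x)%:C%C.
Proof. exact/ge0_realC/(ip_pos hH). Qed.

Lemma hnorm2_ge0 x : 0 <= hnorm2 x.
Proof. by rewrite -ler0c -ip_hnorm2; exact: (ip_pos hH). Qed.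

Lemma hnorm_ge0 x : 0 <= hn x.
Proof. exact: sqrtr_ge0. Qed.

Lemma hnorm_sqr x : hn x ^+ 2 = hnorm2 x.
Proof. by rewrite sqr_sqrtr ?hnorm2_ge0. Qed.

Lemma hnorm2_eq0 x : hnorm2 x = 0 -> x = 0.
Proof. by move=> x0; apply: (ip_definite hH); rewrite ip_hnorm2 x0. Qed.

Lemma ip_inj x y : (forall z, ip z x = ip z y) -> x = y.
Proof.
move=> xy; apply/eqP; rewrite -subr_eq0; apply/eqP; apply: (ip_definite hH).
suff : ip (x - y) (x + -1 *: y) = 0 by rewrite scaleN1r.
by rewrite (ipDr hH) (ipZr hH) xy rmorphN1 mulN1r subrr.
Qed.

Lemma hnorm0 : hn 0 = 0.
Proof. by rewrite /hnorm (ip0l hH) sqrtr0. Qed.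

Lemma hnorm2D x y :
  hnorm2 (x + y) = hnorm2 x + hnorm2 y + 2 * complex.Re (ip x y).
Proof.
rewrite /hnorm2 (ipDl hH) !(ipDr hH) !ReD (ip_hermitian hH x y) ReJ; ring.
Qed.

Lemma hnorm2Z c x : hnorm2 (c *: x) = complex.Re (c * c^*) * hnorm2 x.
Proof.
by rewrite /hnorm2 (ipZl hH) (ipZr hH) mulrA ip_hnorm2 mulrC ReZ mulrC.
Qed.

Lemma hnormZ c x : hn (c *: x) = Num.sqrt (complex.Re (c * c^*)) * hn x.
Proof.
rewrite /hnorm -!/(hnorm2 _) hnorm2Z sqrtrM //.
by have := mul_conjC_ge0 c; rewrite lecE => /andP[].
Qed.

Lemma hnormZr (t : R) x : hn (t%:C%C *: x) = `|t| * hn x.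
Proof.
by rewrite hnormZ conj_realC -rmorphM /= -expr2 sqrtr_sqr.
Qed.

Lemma hnormN x : hn (- x) = hn x.
Proof. by rewrite -scaleN1r hnormZ rmorphN1 mulrNN mulr1 /= sqrtr1 mul1r. Qed.

Lemma Re_ip_le_mean x y : complex.Re (ip x y) <= (hnorm2 x + hnorm2 y) / 2.
Proof.
have := hnorm2_ge0 (x - y).
rewrite hnorm2D -scaleN1r hnorm2Z (ipZr hH) rmorphN1 mulrNN mulr1 mulN1r ReN /=.
lra.
Qed.

Lemma cauchy_schwarz x y : complex.Re (ip x y) <= hn x * hn y.
Proof.
rewrite -sqrtrM ?hnorm2_ge0 // -!/(hnorm2 _).
have [/hnorm2_eq0 ->|y0] := eqVneq (hnorm2 y) 0.
  by rewrite (ip0r hH) sqrtr_ge0.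
have y_gt0 : 0 < hnorm2 y by rewrite lt_neqAle eq_sym y0 hnorm2_ge0.
apply: le_trans (ler_norm _) _; rewrite -sqrtr_sqr; apply: ler_wsqrtr.
set t := complex.Re _.
have := hnorm2_ge0 (x + (- t / hnorm2 y)%:C%C *: y).
rewrite hnorm2D hnorm2Z (ipZr hH) !conj_realC !ReZ -/t /=.
have -> : hnorm2 x + - t / hnorm2 y * (- t / hnorm2 y) * hnorm2 y
    + 2 * (- t / hnorm2 y * t) = hnorm2 x - t ^+ 2 / hnorm2 y.
  by field.
by rewrite subr_ge0 ler_pdivrMr.
Qed.

Lemma hnormD x y : hn (x + y) <= hn x + hn y.
Proof.
rewrite -(@ler_pXn2r _ 2) ?nnegrE ?addr_ge0 ?hnorm_ge0 //.
rewrite sqrrD !hnorm_sqr hnorm2D; have := cauchy_schwarz x y; lra.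
Qed.

Lemma hnorm_sum I (r : seq I) (P : pred I) (F : I -> H) :
  hn (\sum_(i <- r | P i) F i) <= \sum_(i <- r | P i) hn (F i).
Proof.
apply: (big_ind2 (fun x t => hn x <= t)) => [|x1 t1 x2 t2 h1 h2|//].
  by rewrite hnorm0.
exact: le_trans (hnormD _ _) (lerD h1 h2).
Qed.

End HilbertNorm.

(** * Bounded operators and the operator norm *)

Section BoundedOperators.
Context {R : realType} {H : lmodType R[i]} {ip : H -> H -> R[i]}
  (hH : is_hilbert ip).
Implicit Types (T S : H -> H).
Local Notation hn := (hnorm ip).
Local Notation bdd := (bounded_op ip).

Lemma bounded_op_ge0 T : bdd T ->
  exists2 M : R, 0 <= M & forall x, hn (T x) <= M * hn x.
Proof.
case=> _ [M HM]; exists `|M| => // x.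
by apply: le_trans (HM x) _; rewrite ler_wpM2r ?hnorm_ge0 // ler_norm.
Qed.

Lemma bounded_op0 : bdd (fun=> 0).
Proof.
split=> [c x y|]; first by rewrite scaler0 addr0.
by exists 0 => x; rewrite (hnorm0 hH) mul0r.
Qed.

Lemma bounded_op_id : bdd id.
Proof. by split=> //; exists 1 => x; rewrite mul1r. Qed.

Lemma bounded_opD T S : bdd T -> bdd S -> bdd (fun x => T x + S x).
Proof.
move=> [lT [M HM]] [lS [M' HM']]; split=> [c x y|].
  by rewrite lT lS scalerDr addrACA.
exists (M + M') => x; rewrite mulrDl.
exact: le_trans (hnormD hH _ _) (lerD (HM x) (HM' x)).
Qed.

Lemma bounded_opZ c T : bdd T -> bdd (fun x => c *: T x).
Proof.
move=> [lT [M HM]]; split=> [d x y|].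
  by rewrite lT scalerDr !scalerA mulrC.
exists (Num.sqrt (complex.Re (c * c^*)) * M) => x.
by rewrite (hnormZ hH) -mulrA ler_wpM2l ?sqrtr_ge0.
Qed.

Lemma bounded_op_comp T S : bdd T -> bdd S -> bdd (fun x => T (S x)).
Proof.
move=> bT [lS [M' HM']]; have [M M_ge0 HM] := bounded_op_ge0 T bT.
split=> [d x y|]; first by rewrite lS bT.1.
exists (M * M') => x; apply: le_trans (HM _) _.
by rewrite -mulrA ler_wpM2l.
Qed.

Lemma bounded_op_sum I (r : seq I) (P : pred I) (F : I -> H -> H) :
  (forall i, bdd (F i)) -> bdd (fun x => \sum_(i <- r | P i) F i x).
Proof.
move=> bF; elim: r => [|i r IH].
  by under eq_fun do rewrite big_nil; exact: bounded_op0.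
under eq_fun do rewrite big_cons; case: (P i) => //.
exact: bounded_opD.
Qed.

Lemma bounded_op_Xword n (X : 'I_n -> H -> H) alpha :
  (forall i, bdd (X i)) -> bdd (Xword X alpha).
Proof.
move=> bX; elim: alpha => [|i alpha IH] /=; first exact: bounded_op_id.
exact: bounded_op_comp.
Qed.

Lemma bounded_op_psum n (a : seq 'I_n -> R[i]) (X : 'I_n -> H -> H) N :
  (forall i, bdd (X i)) -> bdd (psum a X N).
Proof.
move=> bX; apply: bounded_op_sum => k; apply: bounded_op_sum => alpha.
exact/bounded_opZ/bounded_op_Xword.
Qed.

(** [|S x|^2 = <T S x, x> <= M |S x| |x|], divided by [|S x|] when it is nonzero. *)
Lemma bounded_op_adjoint T S : bdd T -> is_adjoint ip T S -> bdd S.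
Proof.
move=> bT adj; split=> [c x y|].
  apply: (ip_inj hH) => z; rewrite (ipDr hH) (ipZr hH) -!adj.
  by rewrite (ipDr hH) (ipZr hH).
have [M M_ge0 HM] := bounded_op_ge0 T bT.
exists M => x; have [->|Sx0] := eqVneq (hn (S x)) 0.
  by rewrite mulr_ge0 ?hnorm_ge0.
have Sx_gt0 : 0 < hn (S x) by rewrite lt_neqAle eq_sym Sx0 hnorm_ge0.
rewrite -(ler_pM2l Sx_gt0) -expr2 (hnorm_sqr hH) /hnorm2 -adj.
apply: le_trans (cauchy_schwarz hH _ _) _.
by rewrite mulrA (mulrC (hn (S x))) ler_wpM2r ?hnorm_ge0.
Qed.

Lemma hnorm_le_opnorm T x : bdd T -> hn (T x) <= opnorm ip T * hn x.
Proof.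
move=> bT; have [lT _] := bT; have [M M_ge0 HM] := bounded_op_ge0 T bT.
have [x0|x0] := eqVneq (hn x) 0.
  have : hnorm2 (ip := ip) x = 0 by rewrite -(hnorm_sqr hH) x0 expr0n.
  by move=> /(hnorm2_eq0 hH) ->; rewrite (lin0 _ _ _ lT) (hnorm0 hH) mulr0.
have x_gt0 : 0 < hn x by rewrite lt_neqAle eq_sym x0 hnorm_ge0.
rewrite -ler_pdivrMr // mulrC.
have -> : (hn x)^-1 * hn (T x) = hn (T ((hn x)^-1%:C%C *: x)).
  by rewrite (linZ _ _ _ lT) (hnormZr hH) gtr0_norm ?invr_gt0.
apply: ub_le_sup; last first.
  exists ((hn x)^-1%:C%C *: x); split=> //.
  by rewrite (hnormZr hH) gtr0_norm ?invr_gt0 // mulVf.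
exists M => _ [y [y1 ->]]; apply: le_trans (HM y) _.
by rewrite -[leRHS]mulr1 ler_wpM2l.
Qed.

Lemma opnorm_le T (M : R) : 0 <= M -> (forall x, hn (T x) <= M * hn x) ->
  opnorm ip T <= M.
Proof.
move=> M_ge0 HM; apply: ge_sup.
  by exists (hn (T 0)), 0; rewrite (hnorm0 hH) ler01.
move=> _ [y [y1 ->]]; apply: le_trans (HM y) _.
by rewrite -[leRHS]mulr1 ler_wpM2l.
Qed.

Lemma nc_value_pointwise n (a : seq 'I_n -> R[i]) (X : 'I_n -> H -> H) G u (e : R) :
  (forall i, bdd (X i)) -> nc_value ip a X G -> 0 < e ->
  exists N0, forall N, (N0 <= N)%N -> hn (psum a X N u - G u) <= e.
Proof.
move=> bX [bG cG] e_gt0.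
(* The [+ 1] keeps the divisor positive when [u = 0]. *)
have u1 : 0 < hn u + 1 by rewrite ltr_wpDl ?hnorm_ge0 ?ltr01.
have [N0 _ HN] := (iffLR (cvgr0Pnorm_lt _) cG) _ (divr_gt0 e_gt0 u1).
exists N0 => N /HN /= /(le_lt_trans (ler_norm _)) lt_e.
have bd : bdd (fun h => psum a X N h - G h).
  under eq_fun do rewrite -(scaleN1r (G _)).
  by apply: bounded_opD; [exact: bounded_op_psum|exact: bounded_opZ].
apply: le_trans (hnorm_le_opnorm _ u bd) _.
apply: le_trans (ler_wpM2r (hnorm_ge0 _) (ltW lt_e)) _.
by rewrite mulrAC ler_pdivrMr // ler_pM2l // lerDl ler01.
Qed.

End BoundedOperators.

(** * The noncommutative ball and convergence of the series on it *)

Section Ball.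
Context {R : realType} {H : lmodType R[i]} {ip : H -> H -> R[i]}
  (hH : is_hilbert ip) {n : nat} (gamma : R) (gamma_gt0 : 0 < gamma).
Local Notation hn := (hnorm ip).
Local Notation hn2 := (hnorm2 (ip := ip)).
Implicit Types (V X G : 'I_n -> H -> H) (u : 'I_n -> H).

Lemma sum_hnorm2_adjoint V (Vs : 'I_n -> H -> H) h :
  (forall i, is_adjoint ip (V i) (Vs i)) ->
  \sum_i hn2 (Vs i h) = complex.Re (ip (\sum_i V i (Vs i h)) h).
Proof.
move=> adj; rewrite (ip_suml hH) Re_sum.
by apply: eq_bigr => i _; rewrite adj.
Qed.

(** [|V_i^* h|^2] is one term of [<V V^* h, h> = gamma^2 |h|^2]; the bound passes from [V_i^*] to
    [V_i]. *)
Lemma coisometric_bounded V : coisometric (ip := ip) gamma V ->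
  forall i, bounded_op ip (V i).
Proof.
move=> [lV [Vs [adj VVs]]] i; split; first exact: lV.
exists gamma => x.
have VsE h : hn (Vs i h) <= gamma * hn h.
  rewrite -(@ler_pXn2r _ 2) ?nnegrE ?mulr_ge0 ?hnorm_ge0 ?(ltW gamma_gt0) //.
  rewrite exprMn !(hnorm_sqr hH).
  have := sum_hnorm2_adjoint V Vs h adj.
  rewrite VVs (ipZl hH) ReZ => <-; rewrite (bigD1 i) //= lerDl.
  by apply: sumr_ge0 => j _; exact: (hnorm2_ge0 hH).
have [->|Vx0] := eqVneq (hn (V i x)) 0.
  by rewrite mulr_ge0 ?hnorm_ge0 ?ltW.
have Vx_gt0 : 0 < hn (V i x) by rewrite lt_neqAle eq_sym Vx0 hnorm_ge0.
rewrite -(ler_pM2l Vx_gt0) -expr2 (hnorm_sqr hH) /hnorm2 adj.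
apply: le_trans (cauchy_schwarz hH _ _) _.
apply: le_trans (ler_wpM2l (hnorm_ge0 _) (VsE _)) _.
by rewrite mulrC -mulrA mulrCA.
Qed.

Lemma coisometric_scaled_in_ball V (r : R) (z : R[i]) :
  coisometric (ip := ip) gamma V -> 0 <= r -> r < 1 -> z * z^* = 1 ->
  nc_ball ip gamma (fun i x => (r%:C%C * z) *: V i x).
Proof.
move=> coV r_ge0 r_lt1 zz; have [lV [Vs [adj VVs]]] := coV.
split=> [i|]; first exact/(bounded_opZ hH)/coisometric_bounded.
exists (fun i x => (r%:C%C * z)^* *: Vs i x); split=> [i x y|].
  by rewrite (ipZl hH) (ipZr hH) conjCK adj.
have -> : (fun h => \sum_i (r%:C%C * z) *: V i ((r%:C%C * z)^* *: Vs i h))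
    = (fun h => ((r * gamma) ^+ 2)%:C%C *: h).
  apply/funext => h; under eq_bigr => i _ do rewrite (linZ _ _ _ (lV i)) scalerA.
  rewrite -scaler_sumr VVs scalerA; congr (_ *: _).
  rewrite rmorphM /= conj_realC mulrACA zz mulr1 -!rmorphM /=.
  by rewrite -expr2 -exprMn.
have rg_ge0 : 0 <= r * gamma by rewrite mulr_ge0 // ltW.
apply: (@le_lt_trans _ _ (r * gamma)); last by rewrite gtr_pMl.
rewrite -[leRHS]ger0_norm // -sqrtr_sqr; apply: ler_wsqrtr.
apply: (opnorm_le hH); first exact: sqr_ge0.
by move=> x; rewrite (hnormZr hH) ger0_norm ?sqr_ge0.
Qed.

(** Move [G] to the other side, then use [2 Re <u, G^* h> <= |u|^2 + |G^* h|^2] and [|G^* h|^2 = <G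
    G^* h, h> <= gamma^2 |h|^2]. *)
Lemma ball_row_bound G u h : nc_ball ip gamma G ->
  complex.Re (ip (\sum_j G j (u j)) h) <=
  (gamma ^+ 2 * hn2 h + \sum_j hn2 (u j)) / 2.
Proof.
move=> [bG [Gs [adj Gs_lt]]].
set A := (fun h => _) in Gs_lt.
have bA : bounded_op ip A.
  apply: (bounded_op_sum hH) => j; apply: bounded_op_comp => //.
  exact: (bounded_op_adjoint hH _ _ (bG j) (adj j)).
have A_le : opnorm ip A <= gamma ^+ 2.
  rewrite leNgt; apply/negP => /ltW /ler_wsqrtr.
  by rewrite sqrtr_sqr gtr0_norm // leNgt Gs_lt.
have Gs_le : \sum_j hn2 (Gs j h) <= gamma ^+ 2 * hn2 h.
  rewrite (sum_hnorm2_adjoint G) //; apply: le_trans (cauchy_schwarz hH _ _) _.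
  rewrite -(hnorm_sqr hH) expr2 mulrA ler_wpM2r ?hnorm_ge0 //.
  apply: le_trans (hnorm_le_opnorm hH A h bA) _.
  by rewrite ler_wpM2r ?hnorm_ge0.
rewrite (ip_suml hH) Re_sum.
apply: (@le_trans _ _ (\sum_j (hn2 (u j) + hn2 (Gs j h)) / 2)).
  by apply: ler_sum => j _; rewrite adj; exact: (Re_ip_le_mean hH).
by rewrite -mulr_suml big_split /= addrC ler_pM2r ?invr_gt0 // lerD2r.
Qed.

Context (a : 'I_n -> seq 'I_n -> R[i]).

(** The row [F_k (V)] applied to a column [u] of [H^n], so that all components of [F] are treated
    together. *)
Definition homog_part V k u : H :=
  \sum_j \sum_(alpha : k.-tuple 'I_n) a j alpha *: Xword V alpha (u j).

Lemma psum_scaled V (z : R[i]) K u : (forall i, linear (V i)) ->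
  \sum_j psum (a j) (fun i x => z *: V i x) K (u j) =
  \sum_(k < K) z ^+ k *: homog_part V k u.
Proof.
move=> lV; rewrite /psum exchange_big /=; apply: eq_bigr => k _.
rewrite scaler_sumr; apply: eq_bigr => j _; rewrite scaler_sumr.
apply: eq_bigr => alpha _.
by rewrite Xword_scale // size_tuple !scalerA mulrC.
Qed.

Lemma row_value_pointwise V (z : R[i]) G u (e : R) :
  (forall i, bounded_op ip (V i)) ->
  (forall j, nc_value ip (a j) (fun i x => z *: V i x) (G j)) -> 0 < e ->
  exists N0, forall N, (N0 <= N)%N ->
    hn (\sum_(k < N) z ^+ k *: homog_part V k u - \sum_j G j (u j)) <= e.
Proof.
move=> bV vG e_gt0.
(* An equal share of the error for each component; the [+ 1] covers [n = 0]. *)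
have e'_gt0 : 0 < e / (n%:R + 1) by rewrite divr_gt0 // ltr_wpDl ?ler0n ?ltr01.
have bzV i : bounded_op ip (fun x => z *: V i x) by exact: (bounded_opZ hH).
have /choice[N0 HN0] j := nc_value_pointwise hH n (a j) _ (G j) (u j) _ bzV (vG j) e'_gt0.
exists (\max_j N0 j) => N leN.
rewrite -psum_scaled; last by move=> i; case: (bV i).
rewrite -sumrB; apply: le_trans (hnorm_sum hH _ _ _ _) _.
apply: (@le_trans _ _ (\sum_(j < n) e / (n%:R + 1))).
  by apply: ler_sum => j _; apply: HN0; apply: leq_trans leN; exact: leq_bigmax.
rewrite sumr_const card_ord -[leLHS]mulr_natl mulrCA ler_piMr ?(ltW e_gt0) //.
by rewrite ler_pdivrMr ?mul1r ?lerDl ?ler01 // ltr_wpDl ?ler0n ?ltr01.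
Qed.

Context (Fself : forall X, nc_ball ip gamma X ->
  exists G : 'I_n -> H -> H,
    (forall j, nc_value ip (a j) X (G j)) /\ nc_ball ip gamma G).

(* Convergence at the larger radius [(1 + r) / 2] bounds the homogeneous parts,
   so the tails at radius [r] are geometric, uniformly in the phase [z]. *)
Lemma uniform_tail V u (r e : R) : coisometric (ip := ip) gamma V ->
  0 < r -> r < 1 -> 0 < e ->
  exists K0, forall K z G, (K0 <= K)%N -> z * z^* = 1 ->
    (forall j, nc_value ip (a j) (fun i x => (r%:C%C * z) *: V i x) (G j)) ->
    hn (\sum_(k < K) (r%:C%C * z) ^+ k *: homog_part V k u - \sum_j G j (u j)) <= e.
Proof.
move=> coV r_gt0 r_lt1 e_gt0; have bV := coisometric_bounded V coV.
pose r' := (1 + r) / 2; have r'_gt0 : 0 < r' by rewrite /r'; lra.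
have r'_lt1 : r' < 1 by rewrite /r'; lra.
have one1 : (1 : R[i]) * 1^* = 1 by rewrite conjC1 mulr1.
have [G' [vG' _]] := Fself _ (coisometric_scaled_in_ball V r' 1 coV (ltW r'_gt0) r'_lt1 one1).
have [k1 Hk1] := row_value_pointwise V _ G' u (2^-1) bV vG' ltac:(lra).
pose t := homog_part V ^~ u; pose q := r / r'.
have q_gt0 : 0 < q by rewrite divr_gt0.
have q_lt1 : q < 1 by rewrite ltr_pdivrMr // mul1r /r'; lra.
(* A term is the difference of two consecutive partial sums, each within 1/2 of the limit. *)
have t_le k : (k1 <= k)%N -> r' ^+ k * hn (t k) <= 1.
  move=> k1k; have h0 := Hk1 k k1k; have h1 := Hk1 k.+1 (leqW k1k).
  rewrite -[r' ^+ k]ger0_norm ?exprn_ge0 ?(ltW r'_gt0) // -(hnormZr hH).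
  move: h0 h1; rewrite big_ord_recr /=; set S := \sum_(i < k) _; set g := \sum_j _.
  rewrite mulr1 -rmorphXn /= => h0 h1.
  have -> : (r' ^+ k)%:C%C *: t k = (S + (r' ^+ k)%:C%C *: t k - g) + - (S - g).
    by rewrite opprB addrA subrK addrC addrA addNr add0r.
  apply: le_trans (hnormD hH _ _) _; rewrite (hnormN hH); lra.
have [k2 Hk2] : exists k2, forall k, (k2 <= k)%N -> q ^+ k / (1 - q) <= e / 2.
  have d_gt0 : 0 < e / 2 * (1 - q) by rewrite mulr_gt0 ?divr_gt0 ?subr_gt0.
  have q1 : `|q| < 1 by rewrite gtr0_norm.
  have [k2 _ Hk2] := (iffLR (cvgr0Pnorm_lt _) (cvg_expr q1)) _ d_gt0.
  exists k2 => k /Hk2 /= /ltW; rewrite ger0_norm ?exprn_ge0 ?(ltW q_gt0) // => qk.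
  by rewrite ler_pdivrMr // subr_gt0.
exists (maxn k1 k2) => K z G; rewrite geq_max => /andP[k1K k2K] zz vG.
have zt_le k : (k1 <= k)%N -> hn ((r%:C%C * z) ^+ k *: t k) <= q ^+ k.
  move=> k1k; rewrite (hnormZ hH).
  have -> : (r%:C%C * z) ^+ k * ((r%:C%C * z) ^+ k)^* = ((r ^+ k) ^+ 2)%:C%C.
    rewrite rmorphXn /= -exprMn rmorphM /= conj_realC mulrACA zz mulr1.
    by rewrite -rmorphM -rmorphXn /= -expr2 exprAC.
  rewrite /= sqrtr_sqr ger0_norm ?exprn_ge0 ?(ltW r_gt0) // /q expr_div_n.
  by rewrite ler_pdivlMr ?exprn_gt0 // -mulrA ler_piMr ?exprn_ge0 ?(ltW r_gt0) // mulrC t_le.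
have tail d : hn (\sum_(k < K + d) (r%:C%C * z) ^+ k *: t k
    - \sum_(k < K) (r%:C%C * z) ^+ k *: t k) <= (q ^+ K - q ^+ (K + d)) / (1 - q).
  elim: d => [|d IH]; first by rewrite addn0 !subrr (hnorm0 hH) mul0r.
  rewrite addnS big_ord_recr /= addrAC; apply: le_trans (hnormD hH _ _) _.
  apply: le_trans (lerD IH (zt_le _ _)) _; first by rewrite (leq_trans k1K) ?leq_addr.
  rewrite exprS; move: (q ^+ K) (q ^+ (K + d)) => x y.
  suff -> : (x - y) / (1 - q) + y = (x - q * y) / (1 - q) by [].
  by field; rewrite subr_eq0 eq_sym lt_eqF.
(* [M] may depend on [z] and [G]: the bound on the block from [K] to [K + M] does not depend on its
   length. *)
have [M HM] := row_value_pointwise V _ G u (e / 2) bV vG ltac:(by rewrite divr_gt0).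
have {}HM := HM (K + M)%N (leq_addl _ _); have {}tail := tail M.
have -> : \sum_(k < K) (r%:C%C * z) ^+ k *: homog_part V k u - \sum_j G j (u j) =
   (\sum_(k < K + M) (r%:C%C * z) ^+ k *: homog_part V k u - \sum_j G j (u j)) +
   - (\sum_(k < K + M) (r%:C%C * z) ^+ k *: t k - \sum_(k < K) (r%:C%C * z) ^+ k *: t k).
  by rewrite opprB [RHS]addrC addrA subrK.
apply: le_trans (hnormD hH _ _) _; rewrite (hnormN hH).
apply: le_trans (lerD HM tail) _; rewrite [leRHS]splitr lerD2l.
apply: le_trans _ (Hk2 K k2K); rewrite ler_pM2r ?invr_gt0 ?subr_gt0 //.
by rewrite gerBl exprn_ge0 ?ltW.
Qed.

End Ball.

(** Bounds [r^k0] from below for [r = 1 - s^2], so that one parameter [s] governs both limits. *)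
Lemma bernoulli (R : realType) (k : nat) (x : R) : 0 <= x -> x <= 1 ->
  1 - k%:R * x <= (1 - x) ^+ k.
Proof.
move=> x0 x1; elim: k => [|k IH]; first by rewrite mul0r subr0 expr0.
rewrite exprS; apply: le_trans (ler_wpM2l _ IH); last by rewrite subr_ge0.
rewrite -natr1; have : 0 <= k%:R * x ^+ 2 by rewrite mulr_ge0 ?sqr_ge0.
by rewrite expr2; lra.
Qed.

(** * Vanishing of the homogeneous parts of degree other than one *)

Section HomogeneousParts.
Context {R : realType} {H : lmodType R[i]} {ip : H -> H -> R[i]}
  (hH : is_hilbert ip) {n : nat} (gamma : R) (gamma_gt0 : 0 < gamma).
Local Notation hn := (hnorm ip).
Local Notation hn2 := (hnorm2 (ip := ip)).
Context (a : 'I_n -> seq 'I_n -> R[i]).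
Context (Fself : forall X, nc_ball ip gamma X ->
  exists G : 'I_n -> H -> H,
    (forall j, nc_value ip (a j) X (G j)) /\ nc_ball ip gamma G).
Context (F'0 : free_deriv0 a = 1%:M).

Lemma linear_part (V : 'I_n -> H -> H) j x :
  \sum_(alpha : 1.-tuple 'I_n) a j alpha *: Xword V alpha x = V j x.
Proof.
rewrite (reindex (fun i : 'I_n => [tuple i])) /=; last first.
  exists (fun alpha : 1.-tuple 'I_n => thead alpha) => [i _|alpha _].
    by rewrite theadE.
  by case/tupleP: alpha => i t; rewrite (tuple0 t) theadE; apply: val_inj.
have a1 i : a j [:: i] = (j == i)%:R.
  by have := congr1 (fun M : 'M[R[i]]_n => M j i) F'0; rewrite !mxE.
rewrite (bigD1 j) //= big1 ?a1 ?eqxx ?scale1r ?addr0 // => i ij.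
by rewrite a1 eq_sym (negPf ij) scale0r.
Qed.

(** The linear part contributes [r gamma^2 |h|^2], nearly exhausting the bound [gamma^2 |h|^2]. What
    remains is first order in [s] on the left against second order on the right. *)
Lemma averaged_bound V y h (k0 : nat) (s r e : R) :
  coisometric (ip := ip) gamma V -> k0 != 1%N -> 0 < s -> 0 < r -> r < 1 -> 0 < e ->
  (r - 1) * (gamma ^+ 2 * hn2 h)
    + s * r ^+ k0 * complex.Re (ip (homog_part a V k0 y) h)
  <= s ^+ 2 * ((\sum_j hn2 (y j)) / 2) + e.
Proof.
move=> coV k01 s_gt0 r_gt0 r_lt1 e_gt0; have [lV [Vs [adj VVs]]] := coV.
pose p j := Vs j h.
have p_hn2 : \sum_j hn2 (p j) = gamma ^+ 2 * hn2 h.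
  by rewrite (sum_hnorm2_adjoint hH V) // VVs (ipZl hH) ReZ.
(* The truncation errors enter with weights 1 and [s] and are then paired with [h]. *)
pose e' := e / ((1 + s) * (hn h + 1)).
have h1_gt0 : 0 < hn h + 1 by rewrite ltr_wpDl ?hnorm_ge0 ?ltr01.
have s1_gt0 : 0 < 1 + s by rewrite addr_gt0.
have e'_gt0 : 0 < e' by rewrite divr_gt0 ?mulr_gt0.
have [K1 HK1] := uniform_tail hH gamma gamma_gt0 a Fself V p r e' coV r_gt0 r_lt1 e'_gt0.
have [K2 HK2] := uniform_tail hH gamma gamma_gt0 a Fself V y r e' coV r_gt0 r_lt1 e'_gt0.
(* Past both tails, and large enough for the degrees 1 and [k0] to lie below [K]. *)
pose K := (maxn K1 K2 + k0.+2)%N.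
have K1K : (K1 <= K)%N by rewrite (leq_trans (leq_maxl K1 K2)) ?leq_addr.
have K2K : (K2 <= K)%N by rewrite (leq_trans (leq_maxr K1 K2)) ?leq_addr.
have ltK i : (i < k0.+2)%N -> (i < K)%N by move=> ik; rewrite (leq_trans ik) ?leq_addl.
pose C := s%:C%C * \sum_j ip (p j) (y j).
pose b k := (r ^+ k)%:C%C * ip (homog_part a V k p) h.
pose d k := s%:C%C * ((r ^+ k)%:C%C * ip (homog_part a V k y) h).
pose E := gamma ^+ 2 * hn2 h + s ^+ 2 * ((\sum_j hn2 (y j)) / 2) + e.
have : complex.Re (b 1%N + d k0) <= E.
  apply: (circle_average_bound K k0 b d C E); rewrite ?ltK // => z zz.
  have zz' : z^* * z = 1 by rewrite mulrC.
  have [G [vG ballG]] :=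
    Fself _ (coisometric_scaled_in_ball hH gamma gamma_gt0 V r z coV (ltW r_gt0) r_lt1 zz).
  have {}HK1 := HK1 K z G K1K zz vG; have {}HK2 := HK2 K z G K2K zz vG.
  set Sp := \sum_(k < K) _ in HK1; set gp := \sum_j _ in HK1.
  set Sy := \sum_(k < K) _ in HK2; set gy := \sum_j _ in HK2.
  pose c1 := z^*; pose c2 := s%:C%C * z^* ^+ k0.
  pose u j := c1 *: p j + c2 *: y j.
  have c11 : c1 * c1^* = 1 by rewrite conjCK.
  have c22 : c2 * c2^* = (s ^+ 2)%:C%C.
    rewrite /c2 rmorphM rmorphXn /= conjCK conj_realC mulrACA -exprMn zz' expr1n mulr1.
    by rewrite -rmorphM.
  have c12 : c1 * c2^* = s%:C%C * (z^* * z ^+ k0).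
    by rewrite /c1 /c2 rmorphM rmorphXn /= conjCK conj_realC mulrCA.
  have Gu : \sum_j G j (u j) = c1 *: gp + c2 *: gy.
    rewrite !scaler_sumr -big_split; apply: eq_bigr => j _ /=.
    have [lG _] := ballG.1 j.
    by rewrite (linD _ _ _ lG) !(linZ _ _ _ lG).
  have u_hn2 : \sum_j hn2 (u j) = gamma ^+ 2 * hn2 h + s ^+ 2 * \sum_j hn2 (y j)
      + 2 * complex.Re (z^* * z ^+ k0 * C).
    have -> : z^* * z ^+ k0 * C = \sum_j s%:C%C * (z^* * z ^+ k0) * ip (p j) (y j).
      by rewrite -mulr_sumr /C mulrCA mulrA.
    rewrite Re_sum -p_hn2 !mulr_sumr -!big_split.
    apply: eq_bigr => j _ /=; rewrite (hnorm2D hH) !(hnorm2Z hH) c11 c22 mul1r.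
    by rewrite (ipZl hH) (ipZr hH) mulrA c12.
  have SE : z^* * (\sum_(k < K) z ^+ k * b k) + z^* ^+ k0 * (\sum_(k < K) z ^+ k * d k)
      = ip (c1 *: Sp + c2 *: Sy) h.
    rewrite (ipDl hH) !(ipZl hH) !(ip_suml hH); congr (_ + _).
      congr (_ * _); apply: eq_bigr => k _.
      by rewrite (ipZl hH) /b exprMn rmorphXn /= mulrCA mulrA.
    rewrite !mulr_sumr; apply: eq_bigr => k _.
    by rewrite (ipZl hH) /d /c2 exprMn rmorphXn /=; ring.
  rewrite {}SE; have -> : c1 *: Sp + c2 *: Sy =
      \sum_j G j (u j) + (c1 *: (Sp - gp) + c2 *: (Sy - gy)).
    by rewrite Gu addrACA -!scalerDr !(addrC _ (_ - _)) !subrK.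
  have err : complex.Re (ip (c1 *: (Sp - gp) + c2 *: (Sy - gy)) h) <= e.
    apply: le_trans (cauchy_schwarz hH _ _) _.
    have -> : e = ((1 + s) * e') * (hn h + 1) by rewrite /e'; field; rewrite !gt_eqF.
    apply: ler_pM; rewrite ?hnorm_ge0 ?lerDl ?ler01 // mulrDl mul1r.
    apply: le_trans (hnormD hH _ _) _; rewrite !(hnormZ hH) c11 c22 /= sqrtr1 sqrtr_sqr.
    by rewrite mul1r gtr0_norm // lerD // ler_pM2l.
  have := ball_row_bound hH gamma gamma_gt0 G u h ballG; rewrite u_hn2 (ipDl hH) ReD /E.
  move: err; set x1 := complex.Re _; set x2 := complex.Re _; set x3 := complex.Re _.
  set x4 := hn2 h; set x5 := \sum_j _.
  move=> err bnd; lra.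
have -> : b 1%N = (r * gamma ^+ 2 * hn2 h)%:C%C.
  rewrite /b /homog_part; under eq_bigr => j _ do rewrite linear_part.
  by rewrite VVs (ipZl hH) (ip_hnorm2 hH) -!rmorphM expr1 mulrA.
rewrite ReD !ReZ /= /E; lra.
Qed.

(** Test [averaged_bound] against [h = F_k0 (V) y] itself with [r = 1 - s^2]. After division by [s],
    a positive [|h|^2] is at most a quantity of order [s]. *)
Lemma coisometric_homog_part_eq0 V y (k0 : nat) :
  coisometric (ip := ip) gamma V -> k0 != 1%N -> homog_part a V k0 y = 0.
Proof.
move=> coV k01; set h := homog_part a V k0 y; apply: (hnorm2_eq0 hH).
apply/eqP; rewrite eq_le (hnorm2_ge0 hH) andbT leNgt; apply/negP => D_gt0.
set D := hnorm2 h in D_gt0.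
pose A := gamma ^+ 2 * D; pose B := (\sum_j hn2 (y j)) / 2.
have A_ge0 : 0 <= A by rewrite mulr_ge0 ?sqr_ge0 ?ltW.
have B_ge0 : 0 <= B.
  by rewrite divr_ge0 // sumr_ge0 // => j _; exact: (hnorm2_ge0 hH).
have bound (s : R) : 0 < s -> s < 1 -> (1 - k0%:R * s ^+ 2) * D <= s * (A + B).
  move=> s_gt0 s_lt1.
  have s2_gt0 : 0 < s ^+ 2 by rewrite exprn_gt0.
  have s2_lt1 : s ^+ 2 < 1 by rewrite expr_lt1 // ltW.
  have avg : (1 - s ^+ 2 - 1) * A + s * (1 - s ^+ 2) ^+ k0 * D <= s ^+ 2 * B.
    apply/ler_addgt0Pr => e e_gt0.
    apply: (averaged_bound V y h k0 s (1 - s ^+ 2) e) => //.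
      by rewrite subr_gt0.
    by rewrite ltrBlDr ltrDl.
  have bern := bernoulli _ k0 _ (ltW s2_gt0) (ltW s2_lt1).
  have : s * (1 - k0%:R * s ^+ 2) * D <= s * (1 - s ^+ 2) ^+ k0 * D.
    by rewrite ler_pM2r // ler_pM2l.
  move: avg; set w := (1 - s ^+ 2) ^+ k0 => avg low.
  by rewrite -(ler_pM2l s_gt0); lra.
pose M := A + B + k0.+1%:R * D.
have kD_gt0 : 0 < k0.+1%:R * D by rewrite mulr_gt0.
have M_gt0 : 0 < M by rewrite /M ltr_wpDl ?addr_ge0.
(* Chosen so that [s M = D / 2]. The summand [k0.+1%:R * D] of [M] absorbs the Bernoulli loss
   [k0 s^2 D], and its [+ 1] forces [s <= 1/2] even for [k0 = 0]. *)
pose s := D / (2 * M).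
have s_gt0 : 0 < s by rewrite divr_gt0 // mulr_gt0.
have sM : s * M = D / 2 by rewrite /s; field; rewrite gt_eqF.
have ks_le : k0.+1%:R * s <= 2^-1.
  rewrite -(ler_pM2r D_gt0) mulrAC [leRHS]mulrC -sM mulrC ler_pM2l //.
  by rewrite /M lerDr addr_ge0.
have s_le : s <= 2^-1.
  by apply: le_trans ks_le; rewrite ler_peMl ?ler1n // ltW.
have := bound s s_gt0 (le_lt_trans s_le _); rewrite invf_lt1 ?ltr1n // => /(_ isT).
have -> : s * (A + B) = D / 2 - k0.+1%:R * s * D by rewrite -sM /M; ring.
have ks2 : k0%:R * s ^+ 2 * D <= k0.+1%:R * s * D.
  rewrite ler_pM2r // ler_pM ?sqr_ge0 ?ler_nat //.
  by rewrite expr2 ler_piMl ?(ltW s_gt0) // (le_trans s_le) // invf_le1 ?ler1n.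
lra.
Qed.

Lemma homog_part_eq0 (X : 'I_n -> H -> H) j x (k : nat) :
  (forall i, linear (X i)) -> k != 1%N ->
  \sum_(alpha : k.-tuple 'I_n) a j alpha *: Xword X alpha x = 0.
Proof.
move=> lX k1; apply: (coisometric_vanishing hH gamma j) => //.
  by rewrite gt_eqF.
(* A column supported in slot [j] isolates the component [F_j]. *)
move=> V coV; have := coisometric_homog_part_eq0 V (fun i => if i == j then x else 0) k coV k1.
rewrite /homog_part (bigD1 j) //= [X in _ + X]big1 => [|i ij]; first by rewrite addr0 eqxx.
rewrite (negPf ij) big1 // => alpha _.
by rewrite (lin0 _ _ _ (Xword_linear V alpha coV.1)) scaler0.
Qed.

End HomogeneousParts.

Theorem mainTheorem3 (R : realType) (H : lmodType R[i]) (ip : H -> H -> R[i])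
  (hH : is_hilbert ip) (n : nat) (gamma : R) (gamma_gt0 : 0 < gamma)
  (a : 'I_n -> seq 'I_n -> R[i])
  (Fholo : forall j, free_holo_on gamma (a j))
  (Fself : forall X : 'I_n -> H -> H, nc_ball ip gamma X ->
     exists G : 'I_n -> H -> H,
       (forall j, nc_value ip (a j) X (G j)) /\ nc_ball ip gamma G)
  (F0 : forall j, nc_value ip (a j) (fun _ : 'I_n => fun _ : H => 0)
                                    (fun _ : H => 0))
  (F'0 : free_deriv0 a = 1%:M) :
  forall X : 'I_n -> H -> H, nc_ball ip gamma X ->
    forall j, nc_value ip (a j) X (X j).
Proof.
move=> X [bX _] j; split=> //.
have lX i : linear (X i) by case: (bX i).
apply/cvgr0Pnorm_lt => e e_gt0; exists 2%N => // N /= N2.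
(* Only degree one survives, so every partial sum with at least two terms equals [X j] exactly. *)
have -> : (fun h => psum (a j) X N h - X j h) = fun=> 0.
  apply/funext => h; apply/eqP; rewrite subr_eq0; apply/eqP.
  rewrite /psum (bigD1 (Ordinal N2)) //= [X in _ + X]big1 => [|k k1].
    by rewrite addr0 (linear_part _ F'0).
  by apply: (homog_part_eq0 hH gamma gamma_gt0 a Fself F'0) => //.
apply: le_lt_trans e_gt0; rewrite ger0_norm.
  by apply: (opnorm_le hH) => // x; rewrite (hnorm0 hH) mul0r.
by apply: ub_le_sup; [exists 0 => _ [x [_ ->]]|exists 0; split]; rewrite (hnorm0 hH) ?ler01.
Qed.
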